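(* Let $A$ be a commutative algebra over a field $K$ of characteristic zero, let $\delta_1,\ldots,\delta_s$ be commuting locally nilpotent $K$-derivations of $A$, and let $x_1,\ldots,x_s\in A$ satisfy $\delta_i(x_j)=\delta_{ij}$ (the Kronecker delta) for all $i,j$. Let $\{y_i\mid i\in I\}$ be a set of algebra generators of $A$. Then the map $\phi:A\to A^\delta$ is an algebra epimorphism with $\ker(\phi)=(x_1,\ldots,x_s)$. In particular, $A^\delta\simeq A/(x_1,\ldots,x_s)$. Alternatively, the algebra $A^\delta$ is generated by the elements $\{\phi(y_i)\mid i\in I\}$ that satisfy the defining relations $\mathcal R=\{f(t_i)\in K[t_i\mid i\in I]\mid f(\phi(y_i))\in(x_1,\ldots,x_s)\}$.
   Context: $A^\delta=\bigcap_{i=1}^s\ker\delta_i$. A derivation is locally nilpotent if each element is killed by some power of it. $\phi=\phi_s\phi_{s-1}\cdots\phi_1$ (composition) where $\phi_i(a)=\sum_{k\ge0}(-1)^k\frac{x_i^k}{k!}\delta_i^k(a)$ for $a\in A$; the image of $\phi$ is $A^\delta$. Here $(x_1,\ldots,x_s)$ is the ideal of $A$ generated by $x_1,\ldots,x_s$, and $K[t_i\mid i\in I]$ is the polynomial algebra. That generators satisfy the defining relations $\mathcal R$ means that $\mathcal R$ is the kernel of the surjection $K[t_i\mid i\in I]\to A^\delta$, $t_i\mapsto\phi(y_i)$. *)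

(* Defs.v *)
From HB Require Import structures.
From mathcomp Require Import all_boot all_order all_algebra.
From mathcomp Require Import generic_quotient ring_quotient.
From mathcomp Require Import finmap.
From mathcomp Require Import classical_sets cardinality fsbigop.
From mathcomp.multinomials Require Import monalg.

Set Implicit Arguments.
Unset Strict Implicit.
Unset Printing Implicit Defensive.

Import GRing.Theory.
Local Open Scope ring_scope.

Section Derivations.
Variables (K : fieldType) (A : comAlgType K).

Record derivation := Derivation {
  der_fun :> {linear A -> A};
  derM : forall a b : A, der_fun (a * b) = der_fun a * b + a * der_fun b }.

Definition locally_nilpotent (d : A -> A) : Prop :=
  forall a : A, exists n : nat, iter n d a = 0.

(* The sum ranges over all of nat; [\sum_(k \in _)] is the sum of a finitely
   supported family, which this one is as soon as [d] is locally nilpotent. *)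
Definition phi1 (d : A -> A) (x a : A) : A :=
  \sum_(k \in [set: nat]) (((-1) ^+ k / k`!%:R) *: (x ^+ k * iter k d a)).

(* [foldl] applies the index 0 first, so this is phi_s o ... o phi_1. *)
Definition phi s (d : 'I_s -> derivation) (x : 'I_s -> A) (a : A) : A :=
  foldl (fun b i => phi1 (d i) (x i) b) a (enum 'I_s).

Definition ideal_gen s (x : 'I_s -> A) (a : A) : Prop :=
  exists c : 'I_s -> A, a = \sum_i c i * x i.

End Derivations.

Section Constants.
Variables (K : fieldType) (A : comAlgType K) (s : nat) (d : 'I_s -> derivation A).

Definition constants : {pred A} := [pred a | [forall i, d i a == 0]].

Lemma constantsP (a : A) : reflect (forall i, d i a = 0) (a \in constants).
Proof. exact: 'forall_eqP. Qed.

Lemma der1 (D : derivation A) : D 1 = 0.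
Proof.
have := derM D 1 1; rewrite !mulr1 mul1r => /eqP.
by rewrite -subr_eq0 opprD addrA subrr sub0r oppr_eq0 => /eqP.
Qed.

Lemma constants_subalg : subalg_closed constants.
Proof.
split=> [|c a b /constantsP Ha /constantsP Hb|a b /constantsP Ha /constantsP Hb];
  apply/constantsP => i.
- exact: der1.
- by rewrite linearP Ha Hb scaler0 addr0.
- by rewrite derM Ha Hb mul0r mulr0 addr0.
Qed.

HB.instance Definition _ :=
  GRing.isSubalgClosed.Build K A constants constants_subalg.

Record const_alg := ConstAlg {
  const_val :> A; const_valP : const_val \in constants }.

HB.instance Definition _ := [isSub for const_val].
HB.instance Definition _ := [Choice of const_alg by <:].
HB.instance Definition _ := [SubChoice_isSubAlgebra of const_alg by <:].
HB.instance Definition _ := [SubNzRing_isSubComNzRing of const_alg by <:].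

End Constants.

Section PolynomialAlgebra.
Variables (K : fieldType) (B : comAlgType K) (I : choiceType).

(* The polynomial algebra K[t_i | i in I] is [{malg K[cmonom I]}], the monoid
   algebra of the free commutative monoid on the (possibly infinite) set I. *)
Definition peval (y : I -> B) (p : {malg K[cmonom I]}) : B :=
  \sum_(m <- msupp p) p@_m *: \prod_(i <- finsupp m) y i ^+ m i.

Definition alg_generators (y : I -> B) : Prop :=
  forall b : B, exists p : {malg K[cmonom I]}, peval y p = b.

End PolynomialAlgebra.

(* ring_quotient only makes A / J a ring. Its [idealr] packs a boolean membership
   predicate and properness, so an ideal given by a Prop such as [ideal_gen x]
   has to be matched with a [J : idealr A] having the same elements. *)
Section QuotientAlgebra.
Variables (K : fieldType) (A : comAlgType K) (J : idealr A).
Local Notation Q := {ideal_quot J}.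
Local Open Scope quotient_scope.

Let pi_quotP (q : Q) : exists a, q = \pi_Q a.
Proof. by exists (repr q); rewrite reprK. Qed.

Definition quot_scale (c : K) (q : Q) : Q := \pi_Q (c *: repr q).

Lemma quot_scaleE (c : K) (a : A) : quot_scale c (\pi_Q a) = \pi_Q (c *: a).
Proof.
rewrite /quot_scale; apply/eqP.
rewrite -Quotient.idealrBE -scalerBr -mulr_algl.
apply: (@idealMr _ J); rewrite Quotient.idealrBE; apply/eqP; exact: reprK.
Qed.

Fact quot_scaleA c c' q : quot_scale c (quot_scale c' q) = quot_scale (c * c') q.
Proof. by have [a ->] := pi_quotP q; rewrite !quot_scaleE scalerA. Qed.
Fact quot_scale1 : left_id 1 quot_scale.
Proof. by move=> q; have [a ->] := pi_quotP q; rewrite quot_scaleE scale1r. Qed.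
Fact quot_scaleDr : right_distributive quot_scale +%R.
Proof.
move=> c q r; have [a ->] := pi_quotP q; have [b ->] := pi_quotP r.
by rewrite -rmorphD !quot_scaleE -rmorphD scalerDr.
Qed.
Fact quot_scaleDl q : {morph quot_scale^~ q : c c' / c + c'}.
Proof. by move=> c c'; have [a ->] := pi_quotP q; rewrite !quot_scaleE -rmorphD scalerDl. Qed.

HB.instance Definition _ := GRing.Zmodule_isLmodule.Build K Q
  quot_scaleA quot_scale1 quot_scaleDr quot_scaleDl.

Fact quot_scaleAl (c : K) (q r : Q) : c *: (q * r) = (c *: q) * r.
Proof.
have [a ->] := pi_quotP q; have [b ->] := pi_quotP r.
rewrite -[LHS]/(quot_scale _ _) -[RHS]/(quot_scale _ _ * _).
by rewrite -rmorphM !quot_scaleE -rmorphM scalerAl.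
Qed.

HB.instance Definition _ := GRing.Lmodule_isLalgebra.Build K Q quot_scaleAl.
HB.instance Definition _ := GRing.Lalgebra_isComAlgebra.Build K Q.
End QuotientAlgebra.

(* Main.v *)
(* For commuting locally nilpotent derivations, phi_i(a) is the value at t = x_i
   of exp(- t delta_i)(a) in A[t].  The exponential of a derivation is an algebra
   morphism, hence so is phi_i.  Differentiating in t, the Leibniz rule and
   delta_i(x_i) = 1 give delta_i phi_i = 0, while for j <> i the derivation
   delta_j commutes with phi_i; so phi lands in the constants.  It fixes the
   constants, sends each x_i to 0 and is the identity modulo (x_1, ..., x_s), so
   it is onto and its kernel is exactly this ideal. *)
From HB Require Import structures.
Require Import Defs.
From mathcomp Require Import all_boot all_order all_algebra.
From mathcomp Require Import generic_quotient ring_quotient.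
From mathcomp Require Import classical_sets fsbigop ring.
From mathcomp.multinomials Require Import monalg.

Import GRing.Theory.
Local Open Scope ring_scope.

(** * The coefficients of the series exp(-t) *)

Section ExponentialCoefficients.
Set Implicit Arguments.
Unset Strict Implicit.
Variables (K : fieldType).

Definition expc (k : nat) : K := (-1) ^+ k / k`!%:R.

Lemma expc0 : expc 0 = 1.
Proof. by rewrite /expc expr0 fact0 divr1. Qed.

Hypothesis charK : [pchar K] =i pred0.

Lemma fact_neq0_pchar0 (n : nat) : n`!%:R != 0 :> K.
Proof. by rewrite (pcharf0P K).1 // -lt0n fact_gt0. Qed.

(** Coefficient form of exp(-t)' = -exp(-t). *)
Lemma expcS (k : nat) : expc k.+1 *+ k.+1 = - expc k.
Proof.
rewrite /expc factS mulnC natrM invfM mulrA -[LHS]mulr_natr mulfVK ?(pcharf0P K).1 //.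
by rewrite exprS mulN1r mulNr.
Qed.

(** Coefficient of t^m u^n in exp(-t) exp(-u) = exp(-(t + u)); characteristic zero makes the
    binomial coefficient invertible. *)
Lemma expcM (m n : nat) : expc m * expc n = expc (m + n) *+ 'C(m + n, m).
Proof.
rewrite /expc mulrACA -exprD -invfM -[RHS]mulr_natr -mulrA; congr (_ * _).
rewrite -(bin_fact (leq_addr n m)) addKn natrM [RHS]mulrC [in RHS]invfM mulVKf ?natrM //.
by rewrite (pcharf0P K).1 // -lt0n bin_gt0 leq_addr.
Qed.

End ExponentialCoefficients.

(** * The exponential of one derivation and its value at a point *)

Section Derivations.
Set Implicit Arguments.
Unset Strict Implicit.
Variables (K : fieldType) (A : comAlgType K) (D : derivation A).
Implicit Types (a b x : A) (p q : {poly A}).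

Lemma iter_derD n a b : iter n D (a + b) = iter n D a + iter n D b.
Proof. by elim: n => //= n ->; rewrite linearD. Qed.

Lemma iter_derZ n c a : iter n D (c *: a) = c *: iter n D a.
Proof. by elim: n => //= n ->; rewrite linearZ. Qed.

Lemma iter_der0 n : iter n D 0 = 0.
Proof. by elim: n => //= n ->; rewrite linear0. Qed.

(** Induction on [n]: the product rule yields two sums, which merge by Pascal's rule once their
    extreme terms are split off. *)
Lemma iter_derM n a b :
  iter n D (a * b) =
  \sum_(i < n.+1) (iter i D a * iter (n - i) D b) *+ 'C(n, i).
Proof.
elim: n => [|n IHn]; first by rewrite big_ord1.
rewrite iterS IHn linear_sum /=.
under eq_bigr => i _ do
  rewrite linearMn /= derM mulrnDl -!iterS -subSn -1?ltnS ?ltn_ord //.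
rewrite big_split /= big_ord_recr big_ord_recl /= addrC.
rewrite [RHS]big_ord_recl [X in _ = _ + X]big_ord_recr /=.
under [X in _ = _ + (X + _)]eq_bigr => i _ do rewrite /bump binS mulrnDr.
rewrite big_split /= !bin0 !binn -!addrA; congr (_ + (_ + (_ + _))).
Qed.

(** Chain rule: [E] acts on the coefficients and on the point of evaluation. *)
Lemma der_horner (E : derivation A) p x :
  E p.[x] = (map_poly E p).[x] + p^`().[x] * E x.
Proof.
elim/poly_ind: p => [|p c IHp].
  by rewrite map_poly0 deriv0 !horner0 linear0 mul0r addr0.
(* As [E] is linear but not multiplicative, this is checked on coefficients. *)
have ->: map_poly E (p * 'X + c%:P) = map_poly E p * 'X + (E c)%:P.
  apply/polyP => k; rewrite coef_map_id0 ?linear0 // !coefD !coefMX !coefC.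
  by rewrite linearD coef_map_id0 ?linear0 //; case: k => [|k]; rewrite /= ?linear0.
rewrite derivD derivM derivX derivC addr0 mulr1 !hornerE linearD derM IHp.
ring.
Qed.

(* p is the formal series exp(-tD)(a), a polynomial when D is nilpotent on a. *)
Definition exp_gen a p : Prop := forall k, p`_k = expc K k *: iter k D a.

Lemma exp_gen_ex a : locally_nilpotent D -> exists p, exp_gen a p.
Proof.
move=> /(_ a)[n Dna]; exists (\poly_(k < n) (expc K k *: iter k D a)) => k.
rewrite coef_poly; case: ltnP => // /subnK <-.
by rewrite iterD Dna iter_der0 scaler0.
Qed.

Lemma exp_gen_phi1 x a p : exp_gen a p -> phi1 D x a = p.[x].
Proof.
move=> pP; rewrite /phi1 horner_coef.
rewrite (fsbig_ord +%R _ (fun k => p`_k * x ^+ k)).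
have termE k : (-1) ^+ k / k`!%:R *: (x ^+ k * iter k D a) = p`_k * x ^+ k.
  by rewrite pP scalerAr mulrC.
transitivity (\sum_(k \in [set: nat]%classic) p`_k * x ^+ k).
  exact: eq_fsbigr.
(* Coefficients beyond the size of [p] vanish, so the finite range extends to all of [nat]. *)
apply/esym/fsbig_widen => // k [_ /= /negP]; rewrite -leqNgt => le_pk.
by rewrite nth_default // mul0r.
Qed.

Lemma exp_gen_const a : D a = 0 -> exp_gen a a%:P.
Proof.
move=> Da [|k]; rewrite coefC /= ?expc0 ?scale1r //.
by rewrite -iterS iterSr Da iter_der0 scaler0.
Qed.

Lemma exp_gen_linear c a b p q :
  exp_gen a p -> exp_gen b q -> exp_gen (c *: a + b) (c%:A *: p + q).
Proof.
move=> pP qP k; rewrite coefD coefZ pP qP iter_derD iter_derZ scalerDr.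
by rewrite mulr_algl !scalerA mulrC.
Qed.

Lemma exp_gen_commute (E : derivation A) a p :
  (forall b, E (D b) = D (E b)) -> exp_gen a p -> exp_gen (E a) (map_poly E p).
Proof.
move=> ED pP k; rewrite coef_map_id0 ?linear0 // pP linearZ /=; congr (_ *: _).
by elim: k => //= k <-.
Qed.

(** Used for an exponential series of [a], whose constant term is [a] itself. *)
Lemma horner_mod p x : exists c, p.[x] = c * x + p`_0.
Proof.
elim/poly_ind: p => [|p c _]; first by exists 0; rewrite mul0r horner0 coef0 addr0.
by exists p.[x]; rewrite !hornerE coefD coefMX coefC add0r.
Qed.

Hypothesis D_nilp : locally_nilpotent D.

Lemma phi1_linear x c a b : phi1 D x (c *: a + b) = c *: phi1 D x a + phi1 D x b.
Proof.
have [p pP] := exp_gen_ex a D_nilp; have [q qP] := exp_gen_ex b D_nilp.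
rewrite (exp_gen_phi1 x pP) (exp_gen_phi1 x qP).
by rewrite (exp_gen_phi1 x (exp_gen_linear c pP qP)) hornerD hornerZ mulr_algl.
Qed.

Lemma phi1_const x a : D a = 0 -> phi1 D x a = a.
Proof. by move=> /exp_gen_const/(exp_gen_phi1 x) ->; rewrite hornerC. Qed.

Lemma phi1_id_mod x a : exists c, phi1 D x a = c * x + a.
Proof.
have [p pP] := exp_gen_ex a D_nilp; have [q qE] := horner_mod p x.
by exists q; rewrite (exp_gen_phi1 x pP) qE pP expc0 scale1r.
Qed.

(** In the chain rule the term with [E x] vanishes, and on the coefficients [E] commutes with the
    powers of [D]. *)
Lemma phi1_commute (E : derivation A) x a :
    (forall b, E (D b) = D (E b)) -> E x = 0 ->
  E (phi1 D x a) = phi1 D x (E a).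
Proof.
move=> ED Ex; have [p pP] := exp_gen_ex a D_nilp.
rewrite (exp_gen_phi1 x pP) (exp_gen_phi1 x (exp_gen_commute ED pP)).
by rewrite der_horner Ex mulr0 addr0.
Qed.

Hypothesis charK : [pchar K] =i pred0.

(** The binomial factors of the Leibniz formula are exactly those of [expcM]. *)
Lemma exp_genM a b p q : exp_gen a p -> exp_gen b q -> exp_gen (a * b) (p * q).
Proof.
move=> pP qP k; rewrite coefM iter_derM scaler_sumr; apply: eq_bigr => i _.
have ik: (i <= k)%N by rewrite -ltnS.
rewrite pP qP -scalerAl -scalerAr scalerA (expcM charK) subnKC //.
by rewrite -scalerMnl scalerMnr.
Qed.

Lemma exp_gen_deriv a p : exp_gen a p -> p^`() = - map_poly D p.
Proof.
move=> pP; apply/polyP => k; rewrite coef_deriv coefN coef_map_id0 ?linear0 //.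
by rewrite !pP linearZ /= scalerMnl (expcS charK) scaleNr.
Qed.

Lemma phi1M x a b : phi1 D x (a * b) = phi1 D x a * phi1 D x b.
Proof.
have [p pP] := exp_gen_ex a D_nilp; have [q qP] := exp_gen_ex b D_nilp.
rewrite (exp_gen_phi1 x pP) (exp_gen_phi1 x qP).
by rewrite (exp_gen_phi1 x (exp_genM pP qP)) hornerM.
Qed.

(** With D x = 1 the chain rule gives (D p)(x) + p'(x), where D acts on coefficients, and p' = -D
    p. *)
Lemma der_phi1 x a : D x = 1 -> D (phi1 D x a) = 0.
Proof.
move=> Dx; have [p pP] := exp_gen_ex a D_nilp.
rewrite (exp_gen_phi1 x pP) der_horner (exp_gen_deriv pP) Dx.
by rewrite mulr1 hornerN subrr.
Qed.

(** Since D x = 1 and D 1 = 0, the series of [x] stops at x - t, which vanishes at t = x. *)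
Lemma phi1_slice x : D x = 1 -> phi1 D x x = 0.
Proof.
move=> Dx; suff xP : exp_gen x (x%:P - 'X).
  by rewrite (exp_gen_phi1 x xP) hornerD hornerN hornerC hornerX subrr.
case=> [|[|k]]; rewrite coefB coefC coefX /= ?expc0 ?scale1r ?subr0 //.
  by rewrite Dx sub0r /expc expr1 divr1 scaleN1r.
by rewrite -!iterS !iterSr Dx der1 iter_der0 scaler0.
Qed.

End Derivations.

(** * The ideal generated by the x_i *)

Section IdealGen.
Set Implicit Arguments.
Unset Strict Implicit.
Variables (K : fieldType) (A : comAlgType K) (s : nat) (x : 'I_s -> A).

Lemma ideal_gen0 : ideal_gen x 0.
Proof. by exists (fun=> 0); rewrite big1 // => i _; rewrite mul0r. Qed.

Lemma ideal_genD a b : ideal_gen x a -> ideal_gen x b -> ideal_gen x (a + b).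
Proof.
case=> [c ->] [e ->]; exists (fun i => c i + e i).
by rewrite -big_split; apply: eq_bigr => i _; rewrite mulrDl.
Qed.

Lemma ideal_genN a : ideal_gen x a -> ideal_gen x (- a).
Proof.
case=> [c ->]; exists (fun i => - c i).
by rewrite -sumrN; apply: eq_bigr => i _; rewrite mulNr.
Qed.

Lemma ideal_gen_mul c i : ideal_gen x (c * x i).
Proof.
exists (fun j => if j == i then c else 0).
rewrite (bigD1 i) //= eqxx big1 ?addr0 // => j /negPf ->.
by rewrite mul0r.
Qed.

End IdealGen.

(** * The composite projection onto the constants *)

Section Projection.
Set Implicit Arguments.
Unset Strict Implicit.
Variables (K : fieldType) (A : comAlgType K) (s : nat) (d : 'I_s -> derivation A).
Variable (x : 'I_s -> A).
Hypothesis charK : [pchar K] =i pred0.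
Hypothesis d_comm : forall i j a, d i (d j a) = d j (d i a).
Hypothesis d_nilp : forall i, locally_nilpotent (d i).
Hypothesis d_x : forall i j, d i (x j) = (i == j)%:R.

(** An arbitrary list in place of [enum 'I_s] allows induction on the factors. *)
Local Notation phil l a := (foldl (fun b i => phi1 (d i) (x i) b) a l).

Lemma phil_linear l c a b : phil l (c *: a + b) = c *: phil l a + phil l b.
Proof. by elim: l a b => //= i l IHl a b; rewrite phi1_linear. Qed.

Lemma philM l a b : phil l (a * b) = phil l a * phil l b.
Proof. by elim: l a b => //= i l IHl a b; rewrite phi1M. Qed.

Lemma phil_const l a : a \in constants d -> phil l a = a.
Proof. by move=> /constantsP da; elim: l => //= i l; rewrite phi1_const. Qed.

(** Each factor preserves the kernel of [d i]: factor [i] has its image there, and the others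
    commute with [d i]. *)
Lemma der_phil_eq0 l i a : d i a = 0 -> d i (phil l a) = 0.
Proof.
elim: l a => //= j l IHl a dia; apply: IHl.
have [<-|ij] := eqVneq i j; first by rewrite der_phi1 // d_x eqxx.
by rewrite phi1_commute // ?d_x ?(negPf ij) // dia phi1_const // linear0.
Qed.

Lemma der_phil l i a : i \in l -> d i (phil l a) = 0.
Proof.
elim: l a => //= j l IHl a; rewrite inE => /predU1P[<-|]; last exact: IHl.
by apply: der_phil_eq0; rewrite der_phi1 // d_x eqxx.
Qed.

(** Factors other than [i] fix [x i], a constant of their derivation, until factor [i] sends it to
    0. *)
Lemma phil_slice l i : i \in l -> phil l (x i) = 0.
Proof.
elim: l => //= j l IHl; have [<- _|ij] := eqVneq i j.
  rewrite phi1_slice ?d_x ?eqxx // phil_const //.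
  by apply/constantsP => k; rewrite linear0.
by rewrite inE (negPf ij) /= phi1_const // d_x eq_sym (negPf ij).
Qed.

Lemma phil_id_mod l a : ideal_gen x (phil l a - a).
Proof.
elim: l a => [|i l IHl] a /=; first by rewrite subrr; exact: ideal_gen0.
have [c phiE] := phi1_id_mod (@d_nilp i) (x i) a.
(* The difference telescopes through the value of the first factor. *)
rewrite -(subrKA (phi1 (d i) (x i) a)); apply: ideal_genD => //.
by rewrite phiE addrK; exact: ideal_gen_mul.
Qed.

Lemma phi_constants a : phi d x a \in constants d.
Proof. by apply/constantsP => i; rewrite der_phil // mem_enum. Qed.

(** If phi(a) = 0, then a = -(phi(a) - a) lies in the ideal; conversely phi is additive,
    multiplicative and kills each x_i. *)
Lemma phi_eq0_ideal_gen a : phi d x a = 0 <-> ideal_gen x a.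
Proof.
split=> [phi0|[c ->]].
  have := ideal_genN (phil_id_mod (enum 'I_s) a).
  by rewrite -/(phi d x a) phi0 sub0r opprK.
have philD b e : phi d x (b + e) = phi d x b + phi d x e.
  by have := phil_linear (enum 'I_s) 1 b e; rewrite !scale1r.
apply: (big_ind (fun b => phi d x b = 0)) => [|b e b0 e0|i _].
- by apply: phil_const; rewrite rpred0.
- by rewrite philD b0 e0 addr0.
- by rewrite /phi philM phil_slice ?mem_enum ?mulr0.
Qed.

Lemma phi_lrmorphism :
  exists Phi : {lrmorphism A -> const_alg d}, forall a, val (Phi a) = phi d x a.
Proof.
pose f a : const_alg d := ConstAlg (phi_constants a).
have f_lin : linear f.
  by move=> c a b; apply/val_inj; rewrite /= /phi phil_linear.
have f_mul : monoid_morphism f.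
  split=> [|a b]; apply/val_inj; rewrite /= /phi ?philM //.
  by apply: phil_const; rewrite rpred1.
pose fL := GRing.isLinear.Build K A (const_alg d) *:%R f f_lin.
pose fM := GRing.isMonoidMorphism.Build A (const_alg d) f f_mul.
pose Phi : {lrmorphism A -> const_alg d} := HB.pack f fL fM.
by exists Phi.
Qed.

End Projection.

(** * The first isomorphism theorem for a surjection with a section *)

Section FirstIsomorphism.
Set Implicit Arguments.
Unset Strict Implicit.
Variables (K : fieldType) (A B : comAlgType K).
Variables (f : {lrmorphism A -> B}) (h : B -> A).
Hypothesis hK : cancel h f.
Local Open Scope quotient_scope.

Lemma ker_idealr_closed : idealr_closed [pred a | f a == 0].
Proof.
split=> [||a u v]; rewrite !inE ?rmorph0 ?rmorph1 ?oner_eq0 //.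
by rewrite rmorphD rmorphM /= => /eqP-> /eqP->; rewrite mulr0 addr0.
Qed.

(** Equality in [B] is boolean, so the kernel of [f] is an [idealr]. The map [h] is a set-theoretic
    section, but the class of [h b] depends only on [b], which makes the composite with the
    projection a morphism. *)
Lemma first_isomorphism :
  exists2 J : idealr A, forall a, (a \in J) = (f a == 0)
    & exists g : {lrmorphism B -> {ideal_quot J}}, bijective g.
Proof.
pose J : idealr A := HB.pack (fun a => f a == 0) (isIdealr.Build A _ ker_idealr_closed).
have JE a : (a \in J) = (f a == 0) by [].
exists J => //; pose Q := {ideal_quot J}.
have piE a b : f a = f b -> \pi_Q a = \pi_Q b.
  by move=> fab; apply/eqP; rewrite -Quotient.idealrBE JE rmorphB /= fab subrr.
pose g b : Q := \pi_Q (h b).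
have g_lin : linear g.
  move=> c a b; rewrite /g -[c *: \pi_Q _]/(quot_scale c _) quot_scaleE -rmorphD.
  by apply: piE; rewrite linearD linearZ /= !hK.
have g_mul : monoid_morphism g.
  split=> [|a b]; rewrite /g -?rmorphM -?(rmorph1 (\pi_Q)); apply: piE.
    by rewrite hK rmorph1.
  by rewrite rmorphM /= !hK.
pose gL := GRing.isLinear.Build K B Q *:%R g g_lin.
pose gM := GRing.isMonoidMorphism.Build B Q g g_mul.
pose G : {lrmorphism B -> Q} := HB.pack g gL gM.
exists G; exists (fun q : Q => f (repr q)) => [b|q]; last first.
  by rewrite -[RHS]reprK; apply: piE; rewrite hK.
(* [h b] and the chosen representative of its class differ by an element of the kernel. *)
apply/eqP; rewrite -[X in _ == X]hK -subr_eq0 -rmorphB -JE.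
by rewrite Quotient.idealrBE reprK.
Qed.

End FirstIsomorphism.

(** * Generators, relations and assembly of the result *)

Lemma peval_lrmorphism (K : fieldType) (A B : comAlgType K)
    (f : {lrmorphism A -> B}) (I : choiceType) (y : I -> A) p :
  f (peval y p) = peval (fun i => f (y i)) p.
Proof.
rewrite linear_sum; apply: eq_bigr => m _; rewrite linearZ rmorph_prod.
by congr (_ *: _); apply: eq_bigr => i _; rewrite rmorphXn.
Qed.

Theorem corollary2p11 (K : fieldType) (charK : [pchar K] =i pred0)
    (A : comAlgType K) (s : nat) (d : 'I_s -> derivation A)
    (d_comm : forall (i j : 'I_s) (a : A), d i (d j a) = d j (d i a))
    (d_nilp : forall i : 'I_s, locally_nilpotent (d i))
    (x : 'I_s -> A)
    (d_x : forall i j : 'I_s, d i (x j) = (i == j)%:R)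
    (I : choiceType) (y : I -> A) (y_gen : alg_generators y) :
  exists Phi : {lrmorphism A -> const_alg d},
    [/\ forall a : A, val (Phi a) = phi d x a,
        forall b : const_alg d, exists a : A, Phi a = b,
        forall a : A, Phi a = 0 <-> ideal_gen x a,
        exists2 J : idealr A,
          forall a : A, a \in J <-> ideal_gen x a
          & exists g : {lrmorphism const_alg d -> {ideal_quot J}}, bijective g
      & alg_generators (fun i => Phi (y i)) /\
        forall f : {malg K[cmonom I]},
          peval (fun i => Phi (y i)) f = 0
            <-> ideal_gen x (peval (fun i => phi d x (y i)) f)].
Proof.
have [Phi PhiE] := phi_lrmorphism charK d_comm d_nilp d_x.
(* As phi fixes the constants, the inclusion is a section of [Phi]; surjectivity, the isomorphism
   and generation all rest on this. *)
have PhiK : cancel val Phi.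
  by move=> b; apply/val_inj; rewrite PhiE; apply/phil_const/valP.
have Phi_eq0 a : Phi a = 0 <-> ideal_gen x a.
  rewrite -(phi_eq0_ideal_gen charK d_nilp d_x) -PhiE.
  by split=> [->|Phi0]; [|apply: val_inj].
exists Phi; split=> // [b||].
- by exists (val b); exact: PhiK.
- have [J JE [g g_bij]] := first_isomorphism PhiK.
  exists J; last by exists g.
  by move=> a; rewrite JE -Phi_eq0; split=> /eqP.
split=> [b|p].
  by have [p pE] := y_gen (val b); exists p; rewrite -peval_lrmorphism pE PhiK.
rewrite -Phi_eq0 peval_lrmorphism.
(* Membership of f(phi(y_i)) in the ideal is tested by applying [Phi], and phi is idempotent. *)
suff -> : peval (fun i => Phi (phi d x (y i))) p = peval (fun i => Phi (y i)) p by [].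
apply: eq_bigr => m _; congr (_ *: _); apply: eq_bigr => i _.
by rewrite -PhiE PhiK.
Qed.
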